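(* Let $(\alpha_n(a,k,q),\beta_n(a,k,q))_{n\ge0}$ satisfy, for all parameters $a,k$, all bases $q$, and all $n\ge0$, \[ \beta_{n}(a,k,q) = \sum_{j=0}^{n}\frac{(k/a;q)_{n-j}(k;q)_{n+j}}{(q;q)_{n-j}(aq;q)_{n+j}}\alpha_{j}(a,k,q). \] Let $(g_n)$ be an arbitrary sequence and $e,c$ arbitrary constants. Define $\alpha_n'(a,k,q) = g_n\alpha_n(e,c,q^2)$ and \[ \beta_{n}'(a,k,q)= \sum_{j=0}^{n}\beta_{j}(e,c,q^2)\frac{(1-c q^{4j})(k/a;q)_{n-j}(k;q)_{n+j}(eq^2;q^2)_{2j}}{(1-c)(q;q)_{n-j}(aq;q)_{n+j}(cq^2;q^2)_{2j}} \sum_{r=0}^{n-j}\frac{(1-eq^{4j+4r})(q^{-(n-j)},kq^{n+j};q)_r(e/c,eq^{4j};q^2)_r\, g_{r+j}}{(1-e q^{4j})(a q^{n+j+1},a q^{1-(n-j)}/k;q)_r(cq^{4j+2},q^2;q^2)_r}\left(\frac{q c a}{k e}\right)^r. \] Then $\beta_n'(a,k,q)=\sum_{j=0}^{n}\frac{(k/a;q)_{n-j}(k;q)_{n+j}}{(q;q)_{n-j}(aq;q)_{n+j}}\alpha_j'(a,k,q)$ for all $n\ge0$.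
   Context: $(x;q)_n=\prod_{i=0}^{n-1}(1-xq^i)$, $(x_1,\dots,x_m;q)_n=\prod_i(x_i;q)_n$. Parameters are generic so denominators are nonzero. *)

(* Defs.v *)
(* The identities are rational in all parameters, so they are stated over an
   arbitrary field, the complex numbers being the case of interest. *)
From mathcomp Require Import all_boot all_order all_algebra.

Set Implicit Arguments.
Unset Strict Implicit.
Unset Printing Implicit Defensive.

Import GRing.Theory.
Local Open Scope ring_scope.

(* (x; q)_n *)
Definition qpoch (F : fieldType) (x q : F) (n : nat) : F :=
  \prod_(0 <= i < n) (1 - x * q ^+ i).

(* (x_1, ..., x_m; q)_n *)
Definition qpochs (F : fieldType) (xs : seq F) (q : F) (n : nat) : F :=
  \prod_(x <- xs) qpoch x q n.

(* A sequence depending on (a, k, q) is a function nat -> F -> F -> F -> F, so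
   that [alpha n a k q] is alpha_n(a,k,q). *)
Definition wp_sum (F : fieldType) (alpha : nat -> F -> F -> F -> F)
    (n : nat) (a k q : F) : F :=
  \sum_(0 <= j < n.+1)
    qpoch (k / a) q (n - j) * qpoch k q (n + j)
    / (qpoch q q (n - j) * qpoch (a * q) q (n + j)) * alpha j a k q.

(* Division by zero is total in a field, so the genericity of the parameters
   is made explicit: a, k, q are nonzero and no denominator of [wp_sum]
   vanishes. *)
Record wp_generic (F : fieldType) (a k q : F) : Prop := WpGeneric {
  wpg_a : a != 0;
  wpg_k : k != 0;
  wpg_q : q != 0;
  wpg_qq : forall m : nat, qpoch q q m != 0;
  wpg_aq : forall m : nat, qpoch (a * q) q m != 0
}.

Definition wp_bailey_pair (F : fieldType)
    (alpha beta : nat -> F -> F -> F -> F) : Prop :=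
  forall a k q : F, wp_generic a k q ->
  forall n : nat, beta n a k q = wp_sum alpha n a k q.

Definition wp_alpha' (F : fieldType) (alpha : nat -> F -> F -> F -> F)
    (g : nat -> F) (e c : F) (n : nat) (a k q : F) : F :=
  g n * alpha n e c (q ^+ 2).

(* [q ^ (1 - (n - j)%N%:Z)] is an integer power of q; the subtraction in
   [(n - j)%N] is that of nat, exact since j <= n. *)
Definition wp_beta' (F : fieldType) (beta : nat -> F -> F -> F -> F)
    (g : nat -> F) (e c : F) (n : nat) (a k q : F) : F :=
  \sum_(0 <= j < n.+1)
    beta j e c (q ^+ 2)
    * ((1 - c * q ^+ (4 * j))
       * qpoch (k / a) q (n - j) * qpoch k q (n + j)
       * qpoch (e * q ^+ 2) (q ^+ 2) (2 * j)
       / ((1 - c)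
          * qpoch q q (n - j) * qpoch (a * q) q (n + j)
          * qpoch (c * q ^+ 2) (q ^+ 2) (2 * j)))
    * \sum_(0 <= r < (n - j).+1)
        (1 - e * q ^+ (4 * j + 4 * r))
        * qpochs [:: q ^- (n - j); k * q ^+ (n + j)] q r
        * qpochs [:: e / c; e * q ^+ (4 * j)] (q ^+ 2) r
        * g (r + j)%N
        / ((1 - e * q ^+ (4 * j))
           * qpochs [:: a * q ^+ (n + j + 1);
                        a * q ^ (1 - (n - j)%N%:Z) / k] q r
           * qpochs [:: c * q ^+ (4 * j + 2); q ^+ 2] (q ^+ 2) r)
        * (q * c * a / (k * e)) ^+ r.

(* No denominator of [wp_beta'], nor of the terms [beta j e c (q ^+ 2)] in it,
   vanishes. The factors (a q^(n+j+1); q)_r, (c q^(4j+2); q^2)_r and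
   (a q^(1-(n-j)) / k; q)_r divide (aq; q)_(n+j+r), (c q^2; q^2)_(2j+r) and
   (a q^(1-(n-j)) / k; q)_(n-j) respectively. *)
Record wp_generic' (F : fieldType) (e c a k q : F) : Prop := WpGeneric' {
  wpg'_akq : wp_generic a k q;
  wpg'_ecq2 : wp_generic e c (q ^+ 2);
  wpg'_c : 1 - c != 0;
  wpg'_e : forall j : nat, 1 - e * q ^+ (4 * j) != 0;
  wpg'_cq2 : forall m : nat, qpoch (c * q ^+ 2) (q ^+ 2) m != 0;
  wpg'_ak : forall m : nat, qpoch (a * q ^ (1 - m%:Z) / k) q m != 0
}.

(* Main.v *)
(* Collecting the terms with r + j = s, the coefficient of g_s in beta'_n is
   the weight of alpha'_s times the expression that recovers alpha_s(e,c,q^2)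
   from the beta_j(e,c,q^2), so the theorem reduces to the inversion of the
   WP-Bailey relation. That inversion is an orthogonality relation; its
   off-diagonal sums vanish because all their partial sums have a closed form,
   which at the last but one index is minus the last term. *)
Require Import Defs.
From mathcomp Require Import all_boot all_order all_algebra.
From mathcomp Require Import ring.

Set Implicit Arguments.
Unset Strict Implicit.
Unset Printing Implicit Defensive.

Import GRing.Theory.
Local Open Scope ring_scope.

(** * Shifted factorials and summation over a triangle *)

Lemma qpoch0 (F : fieldType) (x q : F) : qpoch x q 0 = 1.
Proof. by rewrite /qpoch big_nil. Qed.

Lemma qpochS (F : fieldType) (x q : F) n :
  qpoch x q n.+1 = qpoch x q n * (1 - x * q ^+ n).
Proof. by rewrite /qpoch big_nat_recr. Qed.

Lemma qpochD (F : fieldType) (x q : F) m n :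
  qpoch x q (m + n) = qpoch x q m * qpoch (x * q ^+ m) q n.
Proof.
elim: n => [|n IHn]; first by rewrite addn0 qpoch0 mulr1.
by rewrite addnS !qpochS IHn -!mulrA exprD.
Qed.

Lemma qpochSl (F : fieldType) (x q : F) n :
  qpoch x q n.+1 = (1 - x) * qpoch (x * q) q n.
Proof. by rewrite -add1n qpochD qpochS qpoch0 mul1r expr1 expr0 mulr1. Qed.

Lemma qpochs2 (F : fieldType) (x y q : F) n :
  qpochs [:: x; y] q n = qpoch x q n * qpoch y q n.
Proof. by rewrite /qpochs !big_cons big_nil mulr1. Qed.

Lemma qpoch_factor_neq0 (F : fieldType) (x q : F) n :
  qpoch x q n.+1 != 0 -> 1 - x * q ^+ n != 0.
Proof. by rewrite qpochS mulf_eq0 negb_or => /andP[]. Qed.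

(** Each factor satisfies [1 - y = - y * (1 - y^-1)] with [y = z * q ^+ (m + i)], and the new
    factors are read in reverse order. The product of powers of [q] stays unevaluated: it is free of
    [z] and cancels in quotients. *)
Lemma qpoch_rev (F : fieldType) (z q : F) m r : z != 0 -> q != 0 ->
  qpoch (z * q ^+ m) q r =
  (\prod_(0 <= i < r) - q ^+ (m + i)) * z ^+ r
  * qpoch (z^-1 * q ^- (m + r) * q) q r.
Proof.
move=> z0 q0; elim: r => [|r IHr]; first by rewrite big_nil !qpoch0 expr0 !mulr1.
have qz : q ^+ (m + r) != 0 by rewrite expf_neq0.
rewrite qpochS IHr big_nat_recr //= [in RHS]qpochSl.
have -> : z^-1 * q ^- (m + r.+1) * q = z^-1 * q ^- (m + r).
  by rewrite addnS exprSr; field; rewrite qz z0 q0.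
rewrite -[z * _ * _]mulrA -exprD exprSr; field; by rewrite qz z0.
Qed.

(** Reindexing by s = r + j: induction on [n] peels off the row j = 0 and leaves the triangle of [f]
    shifted in both indices. *)
Lemma sum_triangle (V : nmodType) n (f : nat -> nat -> V) :
  \sum_(0 <= j < n.+1) \sum_(0 <= r < (n - j).+1) f j (r + j)%N =
  \sum_(0 <= s < n.+1) \sum_(0 <= j < s.+1) f j s.
Proof.
elim: n f => [|n IHn] f; first by rewrite !big_nat1.
transitivity (f 0 0 + (\sum_(0 <= s < n.+1) f 0 s.+1
    + \sum_(0 <= s < n.+1) \sum_(0 <= j < s.+1) f j.+1 s.+1)).
  rewrite -(IHn (fun j s => f j.+1 s.+1)) addrA; rewrite big_nat_recl // subn0.
  congr (_ + _); first by under eq_bigr do rewrite addn0; rewrite big_nat_recl.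
  by apply: eq_bigr => j _; apply: eq_bigr => r _; rewrite addnS.
rewrite [RHS]big_nat_recl // big_nat1; congr (_ + _).
rewrite -big_split /=; apply: eq_bigr => s _.
by rewrite [RHS]big_nat_recl.
Qed.

(** * Orthogonality *)

(** Up to a factor free of t, the term j = i + t of the coefficient of alpha_i when the WP-Bailey
    relation is substituted into its inverse at n = i + N, with A = a q^(2i) and x = k/a. *)
Definition orth_term (F : fieldType) (A x q : F) (N t : nat) : F :=
  (1 - x * A * q ^+ (2 * t)) * x ^- t * qpoch x^-1 q (N - t)
  * qpoch x q t * qpoch A q (N + t) * qpoch (x * A) q t
  / (qpoch q q (N - t) * qpoch q q t * qpoch (x * A * q) q (N + t)
     * qpoch (A * q) q t).

(* Gosper-type closed form: the indefinite very-well-poised 6phi5 sum with base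
   parameter x A and b = A q^N, c = x, d = q^-N, for which bcd = x A. *)
Lemma orth_partial_sum (F : fieldType) (A x q : F) (M T : nat) :
  x != 0 -> (forall m, qpoch q q m != 0) ->
  (forall m, qpoch (A * q) q m != 0) ->
  (forall m, qpoch (x * A * q) q m != 0) ->
  let N := (M + T).+1 in
  \sum_(0 <= t < T.+1) orth_term A x q N t =
  x ^- T * qpoch x^-1 q M.+1 * qpoch (x * A) q T.+1 * qpoch A q N
  * qpoch (A * q ^+ N.+1) q T * qpoch (x * q) q T
  / ((1 - q ^+ N) * qpoch q q M * qpoch q q T * qpoch (A * q) q T
     * qpoch (x * A * q) q (N + T)).
Proof.
move=> x0 qq Aq Kq; elim: T M => [|T IHT] M /=.
  rewrite addn0 big_nat1 /orth_term muln0 subn0 addn0 !qpoch0 !expr0 !invr1 !mulr1.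
  rewrite !(qpochS (x * A)) !qpoch0 (qpochS q) expr0 -exprS.
  have /qpoch_factor_neq0 := qq M.+1; rewrite -exprS => h.
  by field; rewrite h qq Kq.
rewrite big_nat_recr //=.
(* Raising [M] while lowering [T] keeps [N] fixed, so both partial sums belong to the same [N]. *)
have := IHT M.+1; rewrite /= addSnnS => ->.
set N := (M + T.+1).+1.
have hN : q ^+ N = q ^+ M * q ^+ T * q ^+ 2.
  by rewrite -!exprD; congr (_ ^+ _); rewrite /N addnS addn2.
rewrite /orth_term.
have -> : (N - T.+1 = M.+1)%N by rewrite /N -addSn addnK.
rewrite [qpoch A q (N + _)]qpochD [qpoch (_ * q ^+ N) q _]qpochSl.
rewrite (qpochSl x) (qpochS (A * q ^+ N.+1)) -(mulrA _ (q ^+ N) q) -exprSr.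
have [P hP] : {P | P = N + T}%N by exists (N + T)%N.
rewrite addnS -hP (qpochS (x * A * q) _ P) (qpochS q _ M) (qpochS q _ T).
rewrite (qpochS (A * q)).
rewrite (qpochS (x * A) _ T.+1) (qpochS x^-1 _ M.+1) (qpochS (x * q)).
have h1 := qpoch_factor_neq0 (qq (M + T.+1).+1).
have h2 := qpoch_factor_neq0 (qq M.+1).
have h3 := qpoch_factor_neq0 (qq T.+1).
have h4 := qpoch_factor_neq0 (Aq T.+1).
have h5 := qpoch_factor_neq0 (Kq P.+1).
(* Every power of [q] is written through q^M and q^T; once the remaining Pochhammer symbols become
   variables, the induction step is a rational identity. *)
have e1 : q ^+ (2 * T.+1) = q ^+ T ^+ 2 * q ^+ 2.
  by rewrite -exprM -exprD mulnC mulSn addnC.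
rewrite -exprS -/N hN in h1.
have eP : q ^+ P = q ^+ M * q ^+ T * q ^+ 2 * q ^+ T by rewrite hP exprD hN.
rewrite eP in h5.
have hxT : x ^+ T != 0 by rewrite expf_neq0.
rewrite e1 !eP.
move: (qpoch A q N) (qpoch (A * _) q T) (qpoch (x * q) q T).
move: (qpoch (x * A) q _) (qpoch _ q M.+1).
move=> v4 v5 v1 v2 v3.
rewrite !(exprSr _ N) !(exprSr _ T) !(exprSr _ M) !hN.
move: {h1 h2 h3 h4 h5} (h1, h2, h3, h4, h5) (qq M) (qq T) (Aq T) (Kq P).
move: (qpoch (A * q) q T) (qpoch (x * A * q) q P).
move: (q ^+ M) (q ^+ T) (x ^+ T) hxT (qpoch q q M) (qpoch q q T).
move=> w1 w2 w3 n3 z1 z2 z3 z4 [[[[h1 h2] h3] h4] h5] n4 n5 n6 n7.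
by field; rewrite h1 h2 h3 h4 h5 n3 n4 n5 n6 n7 x0.
Qed.

Lemma orth_sum0 (F : fieldType) (A x q : F) (N : nat) :
  x != 0 -> (forall m, qpoch q q m != 0) ->
  (forall m, qpoch (A * q) q m != 0) ->
  (forall m, qpoch (x * A * q) q m != 0) ->
  \sum_(0 <= t < N.+2) orth_term A x q N.+1 t = 0.
Proof.
move=> x0 qq Aq Kq; rewrite big_nat_recr //=.
(* Taking M = 0 covers all terms but the last. The opposite sign comes from x^-N (1 - 1/x) = -
   x^-(N+1) (1 - x). *)
have := orth_partial_sum 0 N x0 qq Aq Kq; rewrite add0n /= => ->.
rewrite /orth_term subnn [qpoch A q (_ + N.+1)]qpochD.
rewrite (qpochSl (A * q ^+ N.+1)) -(mulrA A) -exprSr (qpochSl x).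
rewrite addnS (qpochS (x * A * q)) !(qpochS x^-1) (qpochS (A * q)).
rewrite (qpochS q q N) !qpoch0.
have e1 : q ^+ (2 * N.+1) = q * q ^+ (N.+1 + N).
  by rewrite -exprS mul2n -addnn addnS.
have h1 := qpoch_factor_neq0 (qq N.+1).
have h2 := qpoch_factor_neq0 (Aq N.+1).
have h3 := qpoch_factor_neq0 (Kq (N.+1 + N).+1).
have h4 : x ^+ N != 0 by rewrite expf_neq0.
rewrite e1 expr0 mulr1 !(exprS _ N).
by field; rewrite x0 h4 h1 h2 h3 qq Aq Kq.
Qed.

(** * Inversion of the WP-Bailey relation *)

(** The kernel is that of [wp_sum] with [a] and [k] exchanged, corrected by very-well-poised factors
    and a power of k/a. *)
Definition wp_inverse (F : fieldType) (beta : nat -> F -> F -> F -> F)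
    (n : nat) (a k q : F) : F :=
  (1 - a * q ^+ (2 * n)) / (1 - a) * \sum_(0 <= j < n.+1)
    (1 - k * q ^+ (2 * j)) / (1 - k)
    * qpoch (a / k) q (n - j) * qpoch a q (n + j)
    / (qpoch q q (n - j) * qpoch (k * q) q (n + j))
    * (k / a) ^+ (n - j) * beta j a k q.

Lemma wp_inversion (F : fieldType) (alpha beta : nat -> F -> F -> F -> F)
    (a k q : F) (n : nat) :
  wp_generic a k q -> 1 - a != 0 -> 1 - k != 0 ->
  (forall m, qpoch (k * q) q m != 0) ->
  (forall j, beta j a k q = wp_sum alpha j a k q) ->
  wp_inverse beta n a k q = alpha n a k q.
Proof.
move=> [a0 k0 q0 qq aq] a1 k1 kq hb.
set x := k / a.
have x0 : x != 0 by rewrite mulf_neq0 ?invr_eq0.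
have xV : a / k = x^-1 by rewrite invf_div.
pose f i j := (1 - k * q ^+ (2 * j)) / (1 - k)
    * qpoch x^-1 q (n - j) * qpoch a q (n + j)
    / (qpoch q q (n - j) * qpoch (k * q) q (n + j)) * x ^+ (n - j)
    * (qpoch x q (j - i) * qpoch k q (j + i)
    / (qpoch q q (j - i) * qpoch (a * q) q (j + i)) * alpha i a k q).
rewrite /wp_inverse xV (eq_bigr (fun j => \sum_(0 <= i < j.+1) f i j)); last first.
  by move=> j _; rewrite hb mulr_sumr.
(* After the exchange of sums, the diagonal i = n is treated first, then the vanishing of each i <
   n. *)
rewrite -sum_triangle big_nat_recr //= subnn big_nat1 add0n big_nat big1 ?add0r.
  rewrite /f !subnn !qpoch0 addnn -mul2n.
  (* Both sides are (z;q)_(2n+1); used at z = a and z = k, this makes the diagonal coefficient 1. *)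
  have shift z : qpoch z q (2 * n) * (1 - z * q ^+ (2 * n))
      = (1 - z) * qpoch (z * q) q (2 * n).
    by rewrite -qpochS qpochSl.
  transitivity (qpoch a q (2 * n) * (1 - a * q ^+ (2 * n))
      * (qpoch k q (2 * n) * (1 - k * q ^+ (2 * n)))
      / ((1 - a) * qpoch (a * q) q (2 * n) * ((1 - k) * qpoch (k * q) q (2 * n)))
      * alpha n a k q).
    by rewrite expr0; field; rewrite a1 k1 aq kq.
  by rewrite !shift divff ?mul1r // !mulf_neq0.
move=> i /andP[_ lt_in].
have [N Nn] : {N | n = (i + N.+1)%N}.
  by exists (n - i).-1; rewrite prednK ?subn_gt0 // subnKC // ltnW.
have -> : (n - i = N.+1)%N by rewrite Nn addKn.
set A := a * q ^+ (2 * i).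
have xA : x * A = k * q ^+ (2 * i) by rewrite mulrA divfK.
have Aq m : qpoch (A * q) q m != 0.
  by have := aq (2 * i + m)%N; rewrite qpochD mulf_eq0 negb_or mulrAC => /andP[].
have Kq m : qpoch (x * A * q) q m != 0.
  by have := kq (2 * i + m)%N; rewrite xA qpochD mulf_eq0 negb_or mulrAC => /andP[].
(* Splitting the first 2i factors off the symbols of index n + j and j + i leaves [orth_term] with
   base [A]. *)
transitivity (x ^+ N.+1 / (1 - k) * qpoch a q (2 * i) * qpoch k q (2 * i)
   / (qpoch (k * q) q (2 * i) * qpoch (a * q) q (2 * i)) * alpha i a k q
   * \sum_(0 <= t < N.+2) orth_term A x q N.+1 t); last by rewrite orth_sum0 ?mulr0.
rewrite mulr_sumr; apply: eq_big_nat => r /andP[_]; rewrite ltnS => le_rN.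
rewrite /f /orth_term addnK -addnA addnn -mul2n (addnC r (2 * i)%N).
have -> : (n - (r + i) = N.+1 - r)%N by rewrite Nn (addnC r) subnDl.
have -> : (n + (r + i) = 2 * i + (N.+1 + r))%N.
  by rewrite Nn mul2n -addnn -!addnA; congr (_ + _)%N; rewrite addnA addnC addnA addnC.
have xr : x ^+ r != 0 by rewrite expf_neq0.
have -> : x ^+ (N.+1 - r) = x ^+ N.+1 / x ^+ r.
  by rewrite -[in RHS](subnK le_rN) exprD mulfK.
rewrite xA in Kq *.
rewrite !(qpochD _ _ (2 * i)%N) (mulrAC k q) (mulrAC a q) -/A mulnDr exprD.
have aq2i := aq (2 * i)%N; have kq2i := kq (2 * i)%N.
by field; rewrite xr k1 aq2i kq2i Aq Kq !qq.
Qed.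

(** * Comparison of the terms of beta' with the inverse relation *)

(** Reversing the last r factors of both symbols of index m + r. At z = k/a it turns the index n - j
    into n - s, with s = r + j. *)
Lemma qpoch_ratio (F : fieldType) (z q : F) m r : z != 0 -> q != 0 ->
  qpoch (z^-1 * q ^- (m + r) * q) q r != 0 -> qpoch q q (m + r) != 0 ->
  qpoch z q (m + r) / qpoch q q (m + r)
  * (qpoch (q ^- (m + r)) q r / qpoch (z^-1 * q ^- (m + r) * q) q r)
  * (q / z) ^+ r = qpoch z q m / qpoch q q m.
Proof.
move=> z0 q0 zr.
rewrite !qpochD (qpoch_rev m r z0 q0) (qpoch_rev m r q0 q0).
rewrite (_ : q^-1 * _ * q = q ^- (m + r)); last by rewrite mulrAC mulVf // mul1r.
rewrite !mulf_eq0 !negb_or => /andP[qm /andP[/andP[Q0 qr] R0]].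
have zr0 : z ^+ r != 0 by rewrite expf_neq0.
by rewrite expr_div_n; field; rewrite zr qm Q0 qr R0 zr0.
Qed.

(** Matches the (j, r) term of beta' with the term j of the inverse at s = r + j in base q^2; [b]
    and [G] stand for beta_j and g_s, and m = n - s. *)
Lemma wp_beta'_coef (F : fieldType) (e c a k q b G : F) (m j r : nat) :
  wp_generic' e c a k q -> let n := (m + r + j)%N in let p := q ^+ 2 in
  b * ((1 - c * q ^+ (4 * j))
     * qpoch (k / a) q (m + r) * qpoch k q (n + j) * qpoch (e * p) p (2 * j)
     / ((1 - c) * qpoch q q (m + r) * qpoch (a * q) q (n + j)
        * qpoch (c * p) p (2 * j)))
  * ((1 - e * q ^+ (4 * j + 4 * r))
     * qpochs [:: q ^- (m + r); k * q ^+ (n + j)] q r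
     * qpochs [:: e / c; e * q ^+ (4 * j)] p r * G
     / ((1 - e * q ^+ (4 * j))
        * qpochs [:: a * q ^+ (n + j + 1);
                     a * q ^ (1 - (m + r)%N%:Z) / k] q r
        * qpochs [:: c * q ^+ (4 * j + 2); p] p r)
     * (q * c * a / (k * e)) ^+ r) =
  qpoch (k / a) q m * qpoch k q (n + (r + j))
    / (qpoch q q m * qpoch (a * q) q (n + (r + j))) * G
  * ((1 - e * p ^+ (2 * (r + j))) / (1 - e)
     * ((1 - c * p ^+ (2 * j)) / (1 - c)
        * qpoch (e / c) p r * qpoch e p (r + j + j)
        / (qpoch p p r * qpoch (c * p) p (r + j + j)) * (c / e) ^+ r * b)).
Proof.
move=> [[a0 k0 q0 qq aq] [e0 c0 p0 pp ep] c1 e1 cp ak] n p; rewrite -/p in p0 pp ep cp.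
have q4 i : q ^+ (4 * i) = p ^+ (2 * i) by rewrite -exprM mulnA.
rewrite -mulnDr !q4 (addnC j r) !qpochs2 (addnA n) (addnAC n r).
have -> : (r + j + j = 2 * j + r)%N by rewrite mul2n -addnn -addnA addnC.
rewrite !(qpochD _ _ (n + j)) !(qpochD _ _ (2 * j)%N).
have -> : a * q ^+ (n + j + 1) = a * q * q ^+ (n + j).
  by rewrite addn1 exprS mulrA.
have -> : c * q ^+ (4 * j + 2) = c * p * p ^+ (2 * j).
  by rewrite exprD q4 mulrAC mulrA.
have akE : a * q ^ (1 - (m + r)%N%:Z) / k = (k / a)^-1 * q ^- (m + r) * q.
  by rewrite expfzDr // expr1z -exprnN invf_div; ring.
rewrite akE.
have z0 : k / a != 0 by rewrite mulf_neq0 ?invr_eq0.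
have zr : qpoch ((k / a)^-1 * q ^- (m + r) * q) q r != 0.
  by have := ak (m + r)%N; rewrite akE addnC qpochD mulf_eq0 negb_or => /andP[].
have zm : qpoch (k / a) q m = qpoch (k / a) q (m + r) / qpoch q q (m + r)
    * (qpoch (q ^- (m + r)) q r / qpoch ((k / a)^-1 * q ^- (m + r) * q) q r)
    * (q / (k / a)) ^+ r * qpoch q q m.
  by rewrite (qpoch_ratio z0 q0 zr (qq _)) divfK.
(* The first factor is absorbed by [qpoch_ratio]; the second is the power in the inverse
   relation. *)
have -> : q * c * a / (k * e) = (q / (k / a)) * (c / e).
  by field; rewrite a0 k0 e0.
have e1' : 1 - e != 0 by have := e1 0%N; rewrite muln0 expr0 mulr1.
have e2 : 1 - e * p ^+ (2 * j) != 0 by rewrite -q4.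
(* This trades the denominator 1 - e q^(4j) for 1 - e and lets the symbol join (e q^(4j); q^2)_r
   into (e; q^2)_(2j+r). *)
have -> : qpoch (e * p) p (2 * j)
    = qpoch e p (2 * j) * (1 - e * p ^+ (2 * j)) / (1 - e).
  by rewrite -qpochS qpochSl mulrAC divff // mul1r.
have := aq (n + j + r)%N; rewrite (qpochD _ _ (n + j)) mulf_eq0 negb_or.
have := cp (2 * j + r)%N; rewrite (qpochD _ _ (2 * j)%N) mulf_eq0 negb_or.
move=> /andP[cn cr] /andP[an ar].
rewrite zm (exprMn r).
move: (qpoch (_^-1 * _ * _) q r) zr ((q / (k / a)) ^+ r) ((c / e) ^+ r) => Z nZ Y1 Y2.
by field; rewrite !qq !pp c1 nZ e1' e2 cn cr an ar.
Qed.

Theorem theorem3p1 (F : fieldType) (alpha beta : nat -> F -> F -> F -> F)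
    (g : nat -> F) (e c : F)
    (Hpair : wp_bailey_pair alpha beta) :
  forall a k q : F, wp_generic' e c a k q ->
  forall n : nat,
    wp_beta' beta g e c n a k q = wp_sum (wp_alpha' alpha g e c) n a k q.
Proof.
move=> a k q H n; pose p := q ^+ 2.
have e1 : 1 - e != 0 by have := wpg'_e H 0; rewrite muln0 expr0 mulr1.
pose f j s := qpoch (k / a) q (n - s) * qpoch k q (n + s)
    / (qpoch q q (n - s) * qpoch (a * q) q (n + s)) * g s
  * ((1 - e * p ^+ (2 * s)) / (1 - e)
     * ((1 - c * p ^+ (2 * j)) / (1 - c)
        * qpoch (e / c) p (s - j) * qpoch e p (s + j)
        / (qpoch p p (s - j) * qpoch (c * p) p (s + j)) * (c / e) ^+ (s - j)
        * beta j e c p)).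
(* For fixed s the inner sum is the weight of alpha'_s times g_s times the inverse at (e, c, q^2),
   which equals alpha_s(e, c, q^2). *)
transitivity (\sum_(0 <= s < n.+1) \sum_(0 <= j < s.+1) f j s); last first.
  apply: eq_bigr => s _; rewrite /wp_alpha'.
  have Hecp := wpg'_ecq2 H.
  rewrite -(wp_inversion s Hecp e1 (wpg'_c H) (wpg'_cq2 H) (Hpair _ _ _ Hecp)).
  by rewrite /wp_inverse -mulr_sumr -[in LHS]mulr_sumr !mulrA.
rewrite -sum_triangle; apply: eq_big_nat => j /andP[_]; rewrite ltnS => le_jn.
rewrite mulr_sumr; apply: eq_big_nat => r /andP[_]; rewrite ltnS => le_r.
have [m nE] : {m | n = m + r + j}%N.
  by exists (n - j - r)%N; rewrite subnK // subnK.
rewrite /f addnK; have -> : (n - (r + j) = m)%N by rewrite nE -addnA addnK.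
have -> : (n - j = m + r)%N by rewrite nE addnK.
rewrite nE; exact: (wp_beta'_coef _ _ m j r H).
Qed.
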